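(* Let $\mathcal H$ be a separable complex Hilbert space and let $w\colon\mathbb N_0\to\mathbb R_{>0}$ satisfy $w(0)=1$, $w^{-1}\in\ell^2(\mathbb N_0)$, and $w^{-2}*w^{-2}\le C\,w^{-2}$ for some constant $C$. Let $F_w^\otimes(\mathcal H)$ be the weighted full Fock space, a unital Banach algebra under $\otimes$, and let $\sigma(F_w^\otimes(\mathcal H))$ be its spectrum, i.e. the set of nonzero multiplicative linear functionals, endowed with the weak-$^*$ topology. Then $$\sigma(F_w^\otimes(\mathcal H))=\left\{\chi=\langle\xi,\cdot\rangle_{F_w^\otimes(\mathcal H)}:\ \xi=\sum_{n=0}^\infty w^{-2}(n)\,\eta^{\otimes n},\ \eta\in(\mathcal H)_{R_w}\right\},$$ where $R_w$ is the radius of convergence of $\sum_{n=0}^\infty w^{-2}(n)z^{2n}$, $z\in\mathbb C$, and $(\mathcal H)_{R_w}$ is the closed ball of radius $R_w$ in $\mathcal H$ centered at the origin. Moreover, under the identification $\eta\mapsto\chi$ above, the weak-$^*$ topology on $\sigma(F_w^\otimes(\mathcal H))$ is equivalent to the weak topology on $(\mathcal H)_{R_w}$.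
   Context: Inner products are conjugate-linear in the first argument. $F_w^\otimes(\mathcal H)$ is the Hilbert space completion of the tensor algebra $\mathbb C\oplus\mathcal H\oplus\mathcal H^{\otimes2}\oplus\cdots$ with respect to the inner product for which different degrees are orthogonal, $\langle a,b\rangle=\bar ab$ for $a,b\in\mathbb C$, and $\langle f_1\otimes\cdots\otimes f_n,g_1\otimes\cdots\otimes g_n\rangle=w^2(n)\prod_{i=1}^n\langle f_i,g_i\rangle_{\mathcal H}$. The unit of the algebra is $\Omega=1\in\mathbb C$, and $\eta^{\otimes0}=\Omega$. Under the stated hypotheses on $w$, the product $\otimes$ extends to a bounded bilinear map on $F_w^\otimes(\mathcal H)$, which is a unital Banach algebra for the operator norm $|||f|||=\sup_{h\ne0}\lVert f\otimes h\rVert/\lVert h\rVert$, equivalent to the Hilbert space norm. Convolution on $\mathbb N_0$: $(u*v)(n)=\sum_{a+b=n}u(a)v(b)$; $w^{-2}(n)=1/w(n)^2$. *)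

(* Defs.v *)
From HB Require Import structures.
From mathcomp Require Import all_boot all_order all_algebra sesquilinear.
From mathcomp Require Import all_classical all_reals all_analysis.
From mathcomp Require Import complex.

Set Implicit Arguments.
Unset Strict Implicit.
Unset Printing Implicit Defensive.

Import Order.TTheory GRing.Theory Num.Theory.
Import numFieldNormedType.Exports.

Local Open Scope classical_set_scope.
Local Open Scope ring_scope.
Local Open Scope complex_scope.

HB.instance Definition _ (R : realType) := NormedModule.copy R[i] (R[i])^o.

HB.mixin Record hasInnerProduct (R : realType) H
    of CompleteNormedModule R[i] H := {
  hdot : H -> H -> R[i];
  hdotC : forall x y, hdot y x = (hdot x y)^*;
  hdot_scalar : forall x, scalar (hdot x);
  hdot_norm : forall x, hdot x x = `|x| ^+ 2 }.

#[short(type="hilbertType")]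
HB.structure Definition Hilbert (R : realType) :=
  {H of CompleteNormedModule R[i] H & hasInnerProduct R H}.

Definition separable (T : topologicalType) :=
  exists2 D : set T, countable D & dense D.

Section Weight.
Variable R : realType.

(* [wm2 w n] is $w^{-2}(n) = 1 / w(n)^2$. *)
Definition wm2 (w : nat -> R) (n : nat) : R := (w n ^+ 2)^-1.

Definition nat_conv (u v : nat -> R) (n : nat) : R :=
  \sum_(a < n.+1) u a * v (n - a)%N.

(* Supremum of the moduli of the complex points at which the series
   $\sum_n w^{-2}(n) z^{2n}$ converges. *)
Definition weight_radius (w : nat -> R) : \bar R :=
  ereal_sup [set (complex.Re `|z|)%:E | z in
    [set z : R[i] | cvgn (series (fun n => (wm2 w n)%:C * z ^+ (2 * n)))]].

End Weight.

Section WeakTopology.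
Variables (R : realType) (H : normedModType R[i]).

Definition continuous_dual :=
  {phi : H -> R[i] | scalar phi /\ continuous phi}.

Definition dual_eval (x : H) : {ptws continuous_dual -> R[i]} :=
  fun phi => sval phi x.

(* $H$ with the coarsest topology making every element of its continuous dual
   continuous. *)
Definition weak := initial_topology dual_eval.
HB.instance Definition _ := Topological.copy weak (initial_topology dual_eval).

End WeakTopology.

Section FockSpace.
Variables (R : realType) (H F : hilbertType R).

(* $F$, together with the elementary tensors
   [tens [:: f_1; ..; f_n]] $= f_1 \otimes \cdots \otimes f_n$, is the Hilbert
   space completion of the tensor algebra of $H$ for the weighted inner
   product. Multilinearity of [tens] in each degree follows from [fock_dot]:
   the norm of the defect vanishes. Hence [tens] factors through the tensor
   algebra, isometrically and with dense range, and the pair (F, tens) is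
   unique up to a unique unitary. *)
Record weighted_fock (w : nat -> R) (tens : seq H -> F) : Prop := {
  fock_dot : forall u v : seq H, hdot (tens u) (tens v) =
    if size u == size v
    then (w (size u) ^+ 2)%:C * \prod_(p <- zip u v) hdot p.1 p.2
    else 0;
  fock_dense : dense [set f : F | exists s : seq (R[i] * seq H),
    f = \sum_(p <- s) p.1 *: tens p.2] }.

(* The bounded bilinear extension of the product of the tensor algebra, which
   concatenates elementary tensors; it is unique by density. *)
Record fock_product (tens : seq H -> F) (mul : {bilinear F -> F -> F}) :
    Prop := {
  fock_mul_tens : forall u v : seq H, mul (tens u) (tens v) = tens (u ++ v);
  fock_mul_bounded : exists M : R[i],
    forall f g : F, `|mul f g| <= M * `|f| * `|g| }.

(* As a subset of [{ptws F -> R[i]}] the spectrum carries the topology of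
   pointwise convergence on $F$, which is the weak-$*$ topology. *)
Definition spectrum (mul : F -> F -> F) : set {ptws F -> R[i]} :=
  [set chi | [/\ scalar chi,
                 forall f g : F, chi (mul f g) = chi f * chi g
               & exists f : F, chi f != 0]].

Definition fock_ball (w : nat -> R) : set H :=
  [set eta | ((complex.Re `|eta|)%:E <= weight_radius w)%E].

Definition xi_series (w : nat -> R) (tens : seq H -> F) (eta : H) :
    nat -> F :=
  series (fun n => (wm2 w n)%:C *: tens (nseq n eta)).

Definition xi (w : nat -> R) (tens : seq H -> F) (eta : H) : F :=
  limn (xi_series w tens eta).

Definition character_of (w : nat -> R) (tens : seq H -> F) (eta : H) :
    {ptws F -> R[i]} :=
  hdot (xi w tens eta).

End FockSpace.

Arguments fock_ball {R} H w.

(* [f] restricts to a homeomorphism from [A] onto [B], both with the induced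
   topologies. *)
Definition homeomorphism_on (T U : topologicalType) (A : set T) (B : set U)
    (f : T -> U) :=
  [/\ set_bij A B f, {within A, continuous f}
    & exists2 g : U -> T, {in A, cancel f g} & {within B, continuous g}].

(* Main.v *)
(* An element eta of the closed ball gives chi = <xi, .> with
   chi (f_1 (x) .. (x) f_n) = \prod_i <eta, f_i>; the series xi converges even
   on the sphere because the partial sums of \sum_n w^-2(n) r^(2n) are bounded
   by C, by w^-2 * w^-2 <= C w^-2. Conversely a character is automatically
   continuous, its restriction to degree one is <eta, .> by Riesz, and
   p_N = \sum_(n < N) w^-2(n) eta^(x)n satisfies
   `|p_N|^2 = chi p_N <= M `|p_N|, which bounds
   `|p_N|^2 = \sum_(n < N) w^-2(n) `|eta|^(2n) and puts eta in the ball. *)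

Require Import Defs.
From HB Require Import structures.
From mathcomp Require Import all_boot all_order all_algebra sesquilinear.
From mathcomp Require Import all_classical all_reals all_analysis.
From mathcomp Require Import complex ring lra.

Import Order.TTheory GRing.Theory Num.Theory.
Import numFieldNormedType.Exports.

Local Open Scope classical_set_scope.
Local Open Scope ring_scope.

(* The norm of Defs.v takes values in R[i], which is only partially ordered. *)
Definition nrm {R : realType} {V : normedModType R[i]} (x : V) : R :=
  complex.Re `|x|.

Section RealNorm.
Local Open Scope complex_scope.
Context {R : realType}.
Implicit Types V : normedModType R[i].

Lemma nrmE {V} (x : V) : `|x| = (nrm x)%:C.
Proof. by rewrite /nrm RRe_real // normr_real. Qed.

Lemma nrm_ge0 {V} (x : V) : 0 <= nrm x.
Proof. by rewrite -lecR -nrmE normr_ge0. Qed.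

Lemma nrm0_eq0 {V} (x : V) : nrm x = 0 -> x = 0.
Proof. by move=> x0; apply/normr0_eq0; rewrite nrmE x0. Qed.

Lemma nrm0 {V} : nrm (0 : V) = 0.
Proof. by rewrite /nrm normr0. Qed.

Lemma nrmD {V} (x y : V) : nrm (x + y) <= nrm x + nrm y.
Proof. by rewrite -lecR rmorphD /= -!nrmE ler_normD. Qed.

Lemma nrmN {V} (x : V) : nrm (- x) = nrm x.
Proof. by rewrite /nrm normrN. Qed.

Lemma nrmB {V} (x y : V) : nrm (x - y) = nrm (y - x).
Proof. by rewrite -nrmN opprB. Qed.

Lemma nrmZ {V} (a : R[i]) (x : V) : nrm (a *: x) = nrm a * nrm x.
Proof.
by apply: complexI; rewrite rmorphM /= -!nrmE normrZ.
Qed.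

Lemma nrmM (a b : R[i]) : nrm (a * b) = nrm a * nrm b.
Proof. by apply: complexI; rewrite rmorphM /= -!nrmE normrM. Qed.

Lemma nrmX (a : R[i]) n : nrm (a ^+ n) = nrm a ^+ n.
Proof. by apply: complexI; rewrite rmorphXn /= -!nrmE normrX. Qed.

Lemma nrm_real (r : R) : nrm r%:C = `|r|.
Proof.
by rewrite /nrm normc_def /= expr0n addr0 sqrtr_sqr.
Qed.

Lemma nrm_conj (a : R[i]) : nrm a^*%C = nrm a.
Proof. by rewrite /nrm normcJ. Qed.

Lemma Re_le_nrm (a : R[i]) : `|complex.Re a| <= nrm a.
Proof. by rewrite -lecR -nrmE normc_ge_Re. Qed.

Lemma nrm_sqr (a : R[i]) : (nrm a ^+ 2)%:C = a * a^*%C.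
Proof. by rewrite -sqr_normc nrmE rmorphXn. Qed.

Lemma nrm_small {V} (x : V) :
  (forall e : R, 0 < e -> nrm x <= e) -> x = 0.
Proof.
move=> small; apply: nrm0_eq0; apply/eqP; rewrite eq_le nrm_ge0 andbT.
by apply/ler_addgt0Pl => e e0; rewrite addr0; exact: small.
Qed.

Lemma cvg_nrmP {V} {T : Type} (F : set_system T) {FF : Filter F}
    (f : T -> V) (l : V) :
  f @ F --> l <->
  forall e : R, 0 < e -> \forall t \near F, nrm (l - f t) <= e.
Proof.
rewrite cvgrPdist_le; split=> fl e e0.
  have := fl e%:C; rewrite ltcR => /(_ e0).
  by apply: filterS => t; rewrite nrmE lecR.
have eE : e = (complex.Re e)%:C by rewrite RRe_real // gtr0_real.
move: e0; rewrite eE ltcR => /fl.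
by apply: filterS => t; rewrite nrmE lecR.
Qed.

Lemma near_nrm_le {V} (x : V) (e : R) : 0 < e ->
  \forall y \near x, nrm (x - y) <= e.
Proof. by move=> e0; have /cvg_nrmP/(_ e e0) := @cvg_id _ (nbhs x). Qed.

Lemma cvgn_nrmP {V} (u : nat -> V) (l : V) :
  u @ \oo --> l <->
  forall e : R, 0 < e -> exists N, forall n, (N <= n)%N -> nrm (l - u n) <= e.
Proof.
rewrite cvg_nrmP; split=> ul e /ul.
  by move=> [N _ uN]; exists N => n Nn; exact: uN.
by move=> [N uN]; exists N.
Qed.

Lemma cauchy_cvgn_nrm (V : completeNormedModType R[i]) (u : nat -> V) :
  (forall e : R, 0 < e ->
     exists N, forall n, (N <= n)%N -> nrm (u N - u n) <= e) ->
  cvgn u.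
Proof.
move=> uC; apply/cauchy_cvgP; apply: cauchy_exP => e e0.
have eE : e = (complex.Re e)%:C by rewrite RRe_real // gtr0_real.
have e20 : 0 < complex.Re e / 2 by rewrite divr_gt0 // -ltcR -eE.
have [N uN] := uC _ e20; exists (u N); exists N => //= n Nn.
rewrite -ball_normE /= eE nrmE ltcR (le_lt_trans (uN n Nn)) //.
by lra.
Qed.

End RealNorm.

Section InnerProduct.
Local Open Scope complex_scope.
Context {R : realType} {H : hilbertType R}.
Implicit Types x y z : H.

Lemma hdotDr x y z : hdot x (y + z) = hdot x y + hdot x z.
Proof. by have := hdot_scalar x 1 y z; rewrite scale1r mul1r. Qed.

Lemma hdot0r x : hdot x 0 = 0.
Proof. by apply: (addrI (hdot x 0)); rewrite -hdotDr !addr0. Qed.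

Lemma hdotZr x a y : hdot x (a *: y) = a * hdot x y.
Proof. by have := hdot_scalar x a y 0; rewrite hdot0r !addr0. Qed.

Lemma hdotNr x y : hdot x (- y) = - hdot x y.
Proof. by rewrite -scaleN1r hdotZr mulN1r. Qed.

Lemma hdotBr x y z : hdot x (y - z) = hdot x y - hdot x z.
Proof. by rewrite hdotDr hdotNr. Qed.

Lemma hdotDl x y z : hdot (x + y) z = hdot x z + hdot y z.
Proof. by rewrite hdotC hdotDr rmorphD /= -!hdotC. Qed.

Lemma hdotNl x y : hdot (- x) y = - hdot x y.
Proof. by rewrite hdotC hdotNr rmorphN /= -hdotC. Qed.

Lemma hdotBl x y z : hdot (x - y) z = hdot x z - hdot y z.
Proof. by rewrite hdotDl hdotNl. Qed.

Lemma hdotZl a x y : hdot (a *: x) y = a^*%C * hdot x y.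
Proof. by rewrite hdotC hdotZr rmorphM /= -hdotC. Qed.

Lemma hdot_sumr x (I : Type) (s : seq I) (P : pred I) (f : I -> H) :
  hdot x (\sum_(i <- s | P i) f i) = \sum_(i <- s | P i) hdot x (f i).
Proof. exact: (big_morph _ (hdotDr x) (hdot0r x)). Qed.

Lemma hdot_suml x (I : Type) (s : seq I) (P : pred I) (f : I -> H) :
  hdot (\sum_(i <- s | P i) f i) x = \sum_(i <- s | P i) hdot (f i) x.
Proof.
rewrite hdotC hdot_sumr rmorph_sum; apply: eq_bigr => i _.
by rewrite [RHS]hdotC.
Qed.

Lemma hdot_nrm x : hdot x x = (nrm x ^+ 2)%:C.
Proof. by rewrite hdot_norm nrmE rmorphXn. Qed.

Lemma hdot_inj x y : (forall z, hdot x z = hdot y z) -> x = y.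
Proof.
move=> xy; apply/subr0_eq/nrm0_eq0/eqP; rewrite -sqrf_eq0; apply/eqP.
by apply: complexI; rewrite -hdot_nrm hdotBl xy subrr.
Qed.

Lemma nrm_sqrD x y :
  nrm (x + y) ^+ 2 = nrm x ^+ 2 + 2 * complex.Re (hdot x y) + nrm y ^+ 2.
Proof.
have -> : nrm (x + y) ^+ 2 = complex.Re (hdot (x + y) (x + y)).
  by rewrite hdot_nrm.
rewrite hdotDl !hdotDr !raddfD /= !hdot_nrm /=.
rewrite [hdot y x]hdotC; case: (hdot x y) => a b /=; ring.
Qed.

Lemma cauchy_schwarz x y : nrm (hdot x y) <= nrm x * nrm y.
Proof.
have [->|x0] := eqVneq x 0.
  by rewrite hdotC hdot0r conjc0 !nrm0 mul0r.
have nx : 0 < nrm x.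
  by rewrite lt_neqAle nrm_ge0 andbT; apply: contra_neq x0 => /esym/nrm0_eq0.
rewrite -ler_sqr ?nnegrE ?mulr_ge0 ?nrm_ge0 //.
set z := (nrm x ^+ 2)%:C *: y - hdot x y *: x.
have zE : nrm z ^+ 2 = nrm x ^+ 2 *
    (nrm x ^+ 2 * nrm y ^+ 2 - nrm (hdot x y) ^+ 2).
  apply: complexI; rewrite -hdot_nrm {2}/z hdotBr !hdotZr /z !hdotBl !hdotZl.
  rewrite [hdot y x]hdotC !hdot_nrm. rewrite !conjc_real.
  move: (nrm_sqr (hdot x y)).
  move: (nrm x ^+ 2) (nrm y ^+ 2) (nrm _ ^+ 2) => p q r rE.
  rewrite !(rmorphM (real_complex R), rmorphB (real_complex R)) /= rE.
  by ring.
have : 0 <= nrm z ^+ 2 by rewrite sqr_ge0.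
by rewrite zE pmulr_rge0 ?exprn_gt0 // subr_ge0 exprMn.
Qed.

End InnerProduct.

Definition bounded_functional {R : realType} {V : normedModType R[i]}
    (phi : V -> R[i]) :=
  scalar phi /\ exists M : R, forall x, nrm (phi x) <= M * nrm x.

Section BoundedFunctional.
Context {R : realType} {V : normedModType R[i]}.
Implicit Types (phi psi : V -> R[i]).

Lemma scalar_fD {phi} : scalar phi -> {morph phi : x y / x + y}.
Proof. by move=> s x y; have := s 1 x y; rewrite scale1r mul1r. Qed.

Lemma scalar_f0 {phi} : scalar phi -> phi 0 = 0.
Proof. by move=> s; apply: (addrI (phi 0)); rewrite -(scalar_fD s) !addr0. Qed.

Lemma scalar_fZ {phi} : scalar phi -> forall a x, phi (a *: x) = a * phi x.
Proof.
by move=> s a x; have := s a x 0; rewrite (scalar_f0 s) !addr0.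
Qed.

Lemma scalar_fB {phi} : scalar phi -> {morph phi : x y / x - y}.
Proof.
by move=> s x y; rewrite (scalar_fD s) -scaleN1r (scalar_fZ s) mulN1r.
Qed.

Lemma scalar_fsum {phi} (I : Type) (s : seq I) (P : pred I) (f : I -> V) :
  scalar phi -> phi (\sum_(i <- s | P i) f i) = \sum_(i <- s | P i) phi (f i).
Proof. by move=> h; apply: (big_morph _ (scalar_fD h) (scalar_f0 h)). Qed.

Lemma bounded_functionalP phi : bounded_functional phi ->
  exists2 M : R, 0 < M & forall x, nrm (phi x) <= M * nrm x.
Proof.
case=> _ [M MP]; exists (`|M| + 1) => [|x]; first by rewrite ltr_wpDl.
apply: le_trans (MP x) _; rewrite ler_wpM2r ?nrm_ge0 //.
by rewrite (le_trans (ler_norm _)) // lerDl.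
Qed.

Lemma continuous_bounded_functional phi :
  scalar phi -> continuous phi -> bounded_functional phi.
Proof.
move=> s c; split=> //.
have /nbhs_ballP[d /= d0 dP] : \forall x \near (0 : V), `|phi 0 - phi x| < 1.
  by have /cvgrPdist_lt/(_ 1 ltr01) := c 0.
have dE : d = (complex.Re d)%:C%C by rewrite RRe_real // gtr0_real.
set e := complex.Re d in dE *.
have e0 : 0 < e by rewrite -ltcR -dE.
exists (2 / e) => x; have [->|x0] := eqVneq x 0.
  by rewrite (scalar_f0 s) !nrm0 mulr0.
have nx : 0 < nrm x.
  by rewrite lt_neqAle nrm_ge0 andbT; apply: contra_neq x0 => /esym/nrm0_eq0.
pose t := e / (2 * nrm x).
have t0 : 0 < t by rewrite divr_gt0 // mulr_gt0.
have := dP (t%:C%C *: x); rewrite -ball_normE /= sub0r normrN nrmE dE ltcR.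
rewrite nrmZ nrm_real (gtr0_norm t0) (scalar_f0 s) sub0r normrN nrmE.
rewrite (scalar_fZ s) nrmM nrm_real (gtr0_norm t0).
have -> : t * nrm x = e / 2 by rewrite /t; field; rewrite gt_eqF.
move=> /(_ ltac:(lra)); rewrite -[1]/(1%:C%C) ltcR => tphi.
have -> : 2 / e * nrm x = t^-1 by rewrite /t; field; rewrite !gt_eqF.
by rewrite -[t^-1]mul1r ler_pdivlMr // mulrC ltW.
Qed.

Lemma bounded_functional_continuous phi :
  bounded_functional phi -> continuous phi.
Proof.
move=> bphi x; have [M M0 MP] := bounded_functionalP _ bphi.
apply/cvg_nrmP => e e0; have := near_nrm_le x (e / M) (divr_gt0 e0 M0).
apply: filterS => y yx; rewrite -(scalar_fB bphi.1) (le_trans (MP _)) //.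
by rewrite mulrC -ler_pdivlMr.
Qed.

Lemma bounded_functionalB phi psi :
  bounded_functional phi -> bounded_functional psi ->
  bounded_functional (fun x => phi x - psi x).
Proof.
move=> [sphi [M MP]] [spsi [N NP]]; split.
  by move=> a x y; rewrite sphi spsi; ring.
exists (M + N) => x; rewrite (le_trans (nrmD _ _)) // nrmN mulrDl.
exact: lerD.
Qed.

Lemma bounded_functionalMl (a : R[i]) phi :
  bounded_functional phi -> bounded_functional (fun x => a * phi x).
Proof.
move=> [sphi [M MP]]; split.
  by move=> b x y; rewrite sphi; ring.
by exists (nrm a * M) => x; rewrite nrmM -mulrA ler_wpM2l ?nrm_ge0.
Qed.

Lemma bounded_functional_dense_eq0 (D : set V) phi :
  dense D -> bounded_functional phi -> (forall x, D x -> phi x = 0) ->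
  forall x, phi x = 0.
Proof.
move=> dD bphi phiD x; have [M M0 MP] := bounded_functionalP _ bphi.
apply: nrm_small => e e0.
have d0 : 0 < (e / M)%:C%C :> R[i] by rewrite ltcR divr_gt0.
have [||y] := dD (ball x (e / M)%:C%C); [|exact: ball_open|].
  by exists x; exact: ballxx.
 rewrite -ball_normE /= nrmE ltcR => -[xy Dy].
rewrite -[phi x]subr0 -(phiD y Dy) -(scalar_fB bphi.1) (le_trans (MP _)) //.
by rewrite mulrC -ler_pdivlMr // ltW.
Qed.

End BoundedFunctional.

Section Riesz.
Context {R : realType} {H : hilbertType R}.

Lemma hdot_bounded (x : H) : bounded_functional (hdot x).
Proof.
split; first exact: hdot_scalar.
by exists (nrm x) => y; exact: cauchy_schwarz.
Qed.

Lemma parallelogram (x y : H) :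
  nrm (x + y) ^+ 2 + nrm (x - y) ^+ 2 = 2 * nrm x ^+ 2 + 2 * nrm y ^+ 2.
Proof. by rewrite !nrm_sqrD nrmN hdotNr raddfN /=; ring. Qed.

(* The Riesz vector is the minimizer of J. *)
Lemma riesz (phi : H -> R[i]) : bounded_functional phi ->
  exists y, forall x, phi x = hdot y x.
Proof.
move=> bphi; have [M M0 MP] := bounded_functionalP _ bphi.
pose J x := nrm x ^+ 2 - 2 * complex.Re (phi x).
have J_ge x : - M ^+ 2 <= J x.
  have := Re_le_nrm (phi x); rewrite ler_norml => /andP[_ h].
  have := MP x; have := sqr_ge0 (nrm x - M); rewrite /J.
  by nra.
have hinf : has_inf (range J).
  by split; [exists (J 0), 0 | exists (- M ^+ 2) => _ [x _ <-]].
have [m J_inf J_approx] : exists2 m : R, forall x, m <= J x &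
    forall e : R, 0 < e -> exists x, J x <= m + e.
  exists (inf (range J)) => [x|e e0].
    by apply: ge_inf hinf.2 _ _; exists x.
  by have [_ [x _ <-] xe] := inf_adherent e0 hinf; exists x; exact: ltW.
have JE x z : J (x + z) = J x + nrm z ^+ 2
    + 2 * complex.Re (hdot x z - phi z).
  by rewrite /J nrm_sqrD (scalar_fD bphi.1) !raddfD raddfN /=; ring.
have J_dist x y : nrm (x - y) ^+ 2 <= 2 * (J x - m) + 2 * (J y - m).
  have := J_inf (2^-1%:C%C *: (x + y)); rewrite /J nrmZ nrm_real.
  rewrite (scalar_fZ bphi.1) (scalar_fD bphi.1).
  have -> : complex.Re (2^-1%:C%C * (phi x + phi y)) =
      2^-1 * (complex.Re (phi x) + complex.Re (phi y)).
    by case: (phi x) (phi y) => a b [c d] /=; ring.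
  rewrite ger0_norm ?invr_ge0 // exprMn.
  have -> : 2^-1 ^+ 2 = 4^-1 :> R by field.
  by have := parallelogram x y => ? ?; lra.
have /choice[x xP] : forall n, exists x, J x <= m + n.+1%:R^-1.
  by move=> n; apply: J_approx; rewrite invr_gt0.
have xC (e : R) : 0 < e ->
    exists N, forall n, (N <= n)%N -> nrm (x N - x n) <= e.
  move=> e0; have [N _ NP] := near_infty_natSinv_lt (PosNum (divr_gt0
    (exprn_gt0 2 e0) (ltr0n R 4))).
  exists N => n Nn; rewrite -ler_sqr ?nnegrE ?nrm_ge0 ?ltW //.
  have /= := NP N (leqnn N); have /= := NP n Nn.
  have := xP N; have := xP n; have := J_dist (x N) (x n).
  by move: (n.+1%:R^-1) (N.+1%:R^-1) => *; lra.
have [y xy] : exists y : H, x @ \oo --> y.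
  by exists (limn x); exact: cauchy_cvgn_nrm xC.
have y_min z : 0 <= nrm z ^+ 2 + 2 * complex.Re (hdot y z - phi z).
  apply/ler_addgt0Pl => e e0.
  have d0 : 0 < e / (4 * (nrm z + 1)).
    by rewrite divr_gt0 ?mulr_gt0 // ltr_wpDl ?nrm_ge0.
  have /cvgn_nrmP/(_ _ d0)[N1 N1P] := xy.
  have [N2 _ N2P] := near_infty_natSinv_lt (PosNum (divr_gt0 e0 (ltr0n R 2))).
  pose n := maxn N1 N2; have yx := N1P n (leq_maxl _ _).
  have /= n2 := N2P n (leq_maxr _ _).
  have := xP n; have := J_inf (x n + z); rewrite JE => j1 j2.
  have : `|complex.Re (hdot y z - hdot (x n) z)| <= e / 4.
    rewrite (le_trans (Re_le_nrm _)) // -hdotBl.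
    rewrite (le_trans (cauchy_schwarz _ _)) //.
    have -> : e / 4 = e / (4 * (nrm z + 1)) * (nrm z + 1).
      by field; rewrite gt_eqF // ltr_wpDl ?nrm_ge0.
    by rewrite ler_pM ?nrm_ge0 // lerDl.
  rewrite ler_norml => /andP[+ _]; rewrite !raddfB /= in j1 j2 *.
  by move: (n.+1%:R^-1) n2 j1 j2 => *; lra.
exists y => z; apply/esym/subr0_eq; set p : R[i] := hdot y z - phi z.
apply: nrm0_eq0; apply/eqP; rewrite -sqrf_eq0; apply/negPn/negP => p0.
have pp : 0 < nrm p ^+ 2 by rewrite lt_neqAle eq_sym p0 sqr_ge0.
pose s := (nrm z ^+ 2 + 1)^-1.
have z0 : 0 < nrm z ^+ 2 + 1 by rewrite ltr_wpDl ?sqr_ge0.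
have s0 : 0 < s by rewrite invr_gt0.
have := y_min (- (s%:C%C * p^*%C) *: z).
rewrite hdotZr (scalar_fZ bphi.1) -mulrBr -/p nrmZ nrmN nrmM nrm_conj.
rewrite nrm_real (gtr0_norm s0).
have -> : - (s%:C%C * p^*%C) * p = (- (s * nrm p ^+ 2))%:C%C.
  by rewrite rmorphN rmorphM /= nrm_sqr; ring.
rewrite /= !exprMn.
have sz : s * nrm z ^+ 2 = 1 - s by rewrite /s; field; rewrite gt_eqF.
have -> : s ^+ 2 * nrm p ^+ 2 * nrm z ^+ 2 = s * nrm p ^+ 2 * (s * nrm z ^+ 2).
  by ring.
by rewrite sz; have := mulr_gt0 s0 pp; nra.
Qed.

End Riesz.

Section SubmultiplicativeSums.
Context {R : realType}.
Implicit Types (u : nat -> R) (C : R).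

Lemma sum_nat_conv u v N : \sum_(n < N) nat_conv u v n =
  \sum_(a < N) u a * \sum_(b < N - a) v b.
Proof.
elim: N => [|N IH]; first by rewrite !big_ord0.
rewrite big_ord_recr /= IH /nat_conv [in LHS]big_ord_recr /= subnn.
rewrite [RHS]big_ord_recr /= subSn // subnn big_ord1 addrA; congr (_ + _).
rewrite -big_split /=; apply: eq_bigr => a _.
by rewrite subSn 1?ltnW // big_ord_recr /= mulrDr.
Qed.

Lemma sqr_sum_le_nat_conv u N : (forall n, 0 <= u n) ->
  (\sum_(n < N) u n) ^+ 2 <= \sum_(n < N + N) nat_conv u u n.
Proof.
move=> u0; rewrite sum_nat_conv expr2 mulr_suml big_split_ord /= -[leLHS]addr0.
apply: lerD; last first.
  by apply: sumr_ge0 => a _; rewrite mulr_ge0 // sumr_ge0.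
apply: ler_sum => a _; rewrite ler_wpM2l // -addnBAC 1?ltnW //.
by rewrite addnC big_split_ord /= lerDl sumr_ge0.
Qed.

(* The supremum S of the partial sums satisfies S ^ 2 <= C S. *)
Lemma bounded_sum_le u C : 0 <= C -> (forall n, 0 <= u n) ->
  (forall n, nat_conv u u n <= C * u n) ->
  (exists B, forall N, \sum_(n < N) u n <= B) ->
  forall N, \sum_(n < N) u n <= C.
Proof.
move=> C0 u0 uC [B uB] N.
pose U := [set \sum_(n < N) u n | N in setT].
have supU : has_sup U.
  by split; [exists (\sum_(n < 0) u n), 0%N | exists B => _ [n _ <-]].
have U_le n : \sum_(k < n) u k <= sup U.
  by apply: sup_upper_bound supU _ _; exists n.
rewrite leNgt; apply/negP => CN.
have S0 : 0 < sup U by rewrite (le_lt_trans C0) // (lt_le_trans CN).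
have T0 n : 0 <= \sum_(k < n) u k by exact: sumr_ge0.
have T_le m n : (m <= n)%N -> \sum_(k < m) u k <= \sum_(k < n) u k.
  by move=> /subnKC <-; rewrite big_split_ord /= lerDl sumr_ge0.
have : sup U <= C * sup U / \sum_(n < N) u n.
  apply: ge_sup supU.1 _ => _ [n _ <-].
  rewrite ler_pdivlMr ?(le_lt_trans C0) //.
  pose m := maxn n N.
  apply: (@le_trans _ _ ((\sum_(k < m) u k) ^+ 2)).
    by rewrite expr2 ler_pM // T_le // ?leq_maxl ?leq_maxr.
  apply: le_trans (sqr_sum_le_nat_conv _ _ u0) _.
  apply: (@le_trans _ _ (C * \sum_(k < m + m) u k)).
    by rewrite mulr_sumr; apply: ler_sum => k _; exact: uC.
  by rewrite ler_wpM2l.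
by rewrite ler_pdivlMr ?(le_lt_trans C0) // mulrC ler_pM2r // leNgt CN.
Qed.

End SubmultiplicativeSums.

Section Weight.
Context {R : realType} (w : nat -> R).
Hypothesis w_gt0 : forall n, 0 < w n.

Lemma wm2_gt0 n : 0 < wm2 w n.
Proof. by rewrite invr_gt0 exprn_gt0. Qed.

Lemma wm2_ge0 n : 0 <= wm2 w n.
Proof. exact/ltW/wm2_gt0. Qed.

Definition weight_sum (r : R) N := \sum_(k < N) wm2 w k * r ^+ (2 * k).

(* Convergence at z gives terms dominated by a geometric series at r. *)
Lemma weight_sum_bounded (z : R[i]) (r : R) : 0 <= r -> r < nrm z ->
  cvgn (series (fun n => (wm2 w n)%:C%C * z ^+ (2 * n))) ->
  exists B, forall N, weight_sum r N <= B.
Proof.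
move=> r0 rz /cvg_series_cvg_0/cvgP/cvg_seq_bounded/pinfty_ex_gt0[M _ MP].
have z0 : 0 < nrm z by exact: le_lt_trans rz.
pose q := (r / nrm z) ^+ 2.
have q0 : 0 <= q by rewrite sqr_ge0.
have q1 : q < 1.
  rewrite expr_lt1 //; first by rewrite ltr_pdivrMr // mul1r.
  by rewrite divr_ge0 // ltW.
have termE k : wm2 w k * r ^+ (2 * k) = wm2 w k * nrm z ^+ (2 * k) * q ^+ k.
  by rewrite /q -exprM expr_div_n; field; rewrite expf_neq0 // gt_eqF.
have term_le k : wm2 w k * nrm z ^+ (2 * k) <= complex.Re M.
  have := MP k I; rewrite /= nrmE nrmM nrmX nrm_real ger0_norm ?wm2_ge0 //.
  by rewrite lecE => /andP[].
exists (complex.Re M / (1 - q)) => N.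
have M0 : 0 <= complex.Re M.
  apply: le_trans (term_le 0%N).
  by rewrite mulr_ge0 ?wm2_ge0 ?exprn_ge0 ?nrm_ge0.
rewrite ler_pdivlMr ?subr_gt0 //.
apply: (@le_trans _ _ ((\sum_(k < N) complex.Re M * q ^+ k) * (1 - q))).
  rewrite ler_wpM2r ?subr_ge0 ?(ltW q1) //; apply: ler_sum => k _.
  by rewrite termE ler_wpM2r // exprn_ge0.
rewrite -mulr_sumr -mulrA -[leRHS]mulr1 ler_wpM2l // mulrC.
by rewrite -opprB mulNr -subrX1 opprB gerBl exprn_ge0.
Qed.

Lemma weight_sum_le (r : R) C : (forall n,
    nat_conv (wm2 w) (wm2 w) n <= C * wm2 w n) ->
  (exists B, forall N, weight_sum r N <= B) -> forall N, weight_sum r N <= C.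
Proof.
move=> wC; apply: (bounded_sum_le (fun k => wm2 w k * r ^+ (2 * k))) => [|n|n].
- have := wC 0%N; rewrite /nat_conv big_ord1 subnn ler_pM2r ?wm2_gt0 //.
  by apply: le_trans; rewrite wm2_ge0.
- by rewrite mulr_ge0 ?wm2_ge0 // exprM exprn_ge0 // sqr_ge0.
- rewrite mulrA [leLHS](_ : _ = nat_conv (wm2 w) (wm2 w) n * r ^+ (2 * n)).
    by rewrite ler_wpM2r // exprM exprn_ge0 // sqr_ge0.
  rewrite mulr_suml; apply: eq_bigr => a _.
  have an : (a <= n)%N by rewrite -ltnS.
  by rewrite mulrACA -exprD -mulnDr subnKC.
Qed.

Lemma weight_sum_continuous N : continuous (weight_sum ^~ N).
Proof.
have -> : weight_sum ^~ N = horner (\sum_(k < N) wm2 w k *: 'X^(2 * k)).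
  apply/funext => r; rewrite horner_sum; apply: eq_bigr => k _.
  by rewrite hornerZ hornerXn.
exact: continuous_horner.
Qed.

Lemma weight_sum_ball_le (r : R) C : (forall n,
    nat_conv (wm2 w) (wm2 w) n <= C * wm2 w n) ->
  0 <= r -> (r%:E <= weight_radius w)%E -> forall N, weight_sum r N <= C.
Proof.
move=> wC r0 rw N; move: r0; rewrite le_eqVlt => /predU1P[<-|r0].
  apply: weight_sum_le wC _ _; exists (wm2 w 0) => -[|n].
    by rewrite /weight_sum big_ord0 wm2_ge0.
  rewrite /weight_sum big_ord_recl /= mulr1 big1 ?addr0 // => k _.
  by rewrite expr0n mulr0.
have sum_lt s : 0 <= s -> s < r -> weight_sum s N <= C.
  move=> s0 sr; apply: weight_sum_le wC _ _.
  have [_ [z /= zcvg <-]] :=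
    ereal_sup_gt (lt_le_trans (sr : (s%:E < r%:E)%E) rw).
  by rewrite lte_fin => sz; exact: weight_sum_bounded zcvg.
apply: (cvgr_to_le (f := weight_sum ^~ N) (F := r^'-)).
  apply: cvg_at_left_filter; exact: weight_sum_continuous.
near=> s; apply: sum_lt; first by near: s; exact: nbhs_left_ge.
by near: s; exact: nbhs_left_lt.
Unshelve. all: by end_near. Qed.

End Weight.

Section XiSeries.
Context {R : realType} {H F : hilbertType R}.
Variables (w : nat -> R) (tens : seq H -> F).
Hypothesis w_gt0 : forall n, 0 < w n.
Hypothesis F_fock : weighted_fock w tens.
Implicit Types (eta : H) (u v : seq H).

Lemma wm2K n : (wm2 w n)%:C%C * (w n ^+ 2)%:C%C = 1.
Proof. by rewrite -rmorphM mulVf // expf_neq0 // gt_eqF. Qed.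

Lemma tens_nseq_dot n eta u : hdot (tens (nseq n eta)) (tens u) =
  if n == size u then (w n ^+ 2)%:C%C * \prod_(x <- u) hdot eta x else 0.
Proof.
rewrite (fock_dot F_fock) size_nseq; case: eqP => // ->; congr (_ * _).
by elim: u => [|x u IH]; rewrite /= ?big_nil // !big_cons IH.
Qed.

Lemma nrm_tens1 (x : H) : nrm (tens [:: x]) = w 1 * nrm x.
Proof.
have w1 := ltW (w_gt0 1); apply/eqP.
rewrite -(@eqrXn2 _ 2) ?nrm_ge0 ?mulr_ge0 ?nrm_ge0 //; apply/eqP/complexI.
by rewrite -hdot_nrm (fock_dot F_fock) /= big_seq1 hdot_nrm -rmorphM exprMn.
Qed.

Lemma tens1_linear a (x y : H) :
  tens [:: a *: x + y] = a *: tens [:: x] + tens [:: y].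
Proof.
apply/subr0_eq; set d := _ - _.
have d_orth z : hdot (tens [:: z]) d = 0.
  rewrite hdotBr hdotDr hdotZr !(fock_dot F_fock) /= !big_seq1 /=.
  by rewrite hdotDr hdotZr; ring.
have d_orthC z : hdot d (tens [:: z]) = 0 by rewrite hdotC d_orth conjc0.
apply: nrm0_eq0; apply/eqP; rewrite -sqrf_eq0; apply/eqP/complexI.
by rewrite -hdot_nrm {2}/d hdotBr hdotDr hdotZr !d_orthC mulr0 !addr0 subr0.
Qed.

Lemma fock_functional_eq0 (phi : F -> R[i]) : bounded_functional phi ->
  (forall u, phi (tens u) = 0) -> forall f, phi f = 0.
Proof.
move=> bphi phi0.
apply: (bounded_functional_dense_eq0 _ _ (fock_dense F_fock) bphi).
move=> _ [s ->]; rewrite (scalar_fsum _ _ _ _ bphi.1) big1 // => p _.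
by rewrite (scalar_fZ bphi.1) phi0 mulr0.
Qed.

Lemma fock_functional_eq (phi psi : F -> R[i]) :
  bounded_functional phi -> bounded_functional psi ->
  (forall u, phi (tens u) = psi (tens u)) -> phi = psi.
Proof.
move=> bphi bpsi eq_tens; apply/funext => f; apply/subr0_eq.
apply: (fock_functional_eq0 _ (bounded_functionalB _ _ bphi bpsi)) => u.
by rewrite eq_tens subrr.
Qed.

Lemma xi_series_dot eta N u : hdot (xi_series w tens eta N) (tens u) =
  if (size u < N)%N then \prod_(x <- u) hdot eta x else 0.
Proof.
rewrite /xi_series /series /= hdot_suml.
under [in LHS]eq_bigr => k _ do rewrite hdotZl conjc_real tens_nseq_dot.
elim: N => [|N IH]; first by rewrite big_nil.
rewrite big_nat_recr //= IH ltnS; case: (ltngtP (size u) N) => uN.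
- by rewrite mulr0 addr0.
- by rewrite mulr0 addr0.
- by rewrite mulrA wm2K mul1r add0r.
Qed.

Lemma xi_series_dot_series eta m n : (m <= n)%N ->
  hdot (xi_series w tens eta n) (xi_series w tens eta m) =
  (weight_sum w (nrm eta) m)%:C%C.
Proof.
move=> mn; rewrite {2}/xi_series /series /= hdot_sumr big_mkord rmorph_sum.
apply: eq_bigr => k _; rewrite hdotZr xi_series_dot size_nseq.
rewrite (leq_trans (ltn_ord k) mn) rmorphM exprM rmorphXn /= -hdot_nrm.
by rewrite big_nseq -Monoid.iteropE.
Qed.

Lemma xi_series_dist eta m n : (m <= n)%N ->
  nrm (xi_series w tens eta m - xi_series w tens eta n) ^+ 2 =
  weight_sum w (nrm eta) n - weight_sum w (nrm eta) m.
Proof.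
move=> mn; apply: complexI; rewrite -hdot_nrm hdotBl !hdotBr.
rewrite [X in _ - X - _]hdotC !xi_series_dot_series // conjc_real.
by rewrite rmorphB /=; ring.
Qed.

Lemma nrm_xi_series eta N :
  nrm (xi_series w tens eta N) ^+ 2 = weight_sum w (nrm eta) N.
Proof. by apply: complexI; rewrite -hdot_nrm xi_series_dot_series. Qed.

Section Bounded.
Variables (eta : H) (C : R).
Hypothesis eta_C : forall N, weight_sum w (nrm eta) N <= C.

Lemma xi_series_cvg : xi_series w tens eta @ \oo --> xi w tens eta.
Proof.
apply: cauchy_cvgn_nrm => e e0.
have W_nd : nondecreasing_seq (weight_sum w (nrm eta)).
  apply/nondecreasing_seqP => n; rewrite /weight_sum big_ord_recr /= lerDl.
  by rewrite mulr_ge0 ?(wm2_ge0 _ w_gt0) // exprn_ge0 ?nrm_ge0.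
have W_cvg : cvgn (weight_sum w (nrm eta)).
  by apply: (nondecreasing_is_cvgn W_nd); exists C => _ [n _ <-].
have /cvgrPdist_le/(_ (e ^+ 2)) := W_cvg.
rewrite exprn_gt0 // => /(_ isT)[N _ NP]; exists N => n Nn.
rewrite -ler_sqr ?nnegrE ?nrm_ge0 ?(ltW e0) // xi_series_dist //.
apply: (le_trans _ (NP N (leqnn N))).
rewrite (le_trans _ (ler_norm _)) // lerB //.
exact: nondecreasing_cvgn_le W_nd W_cvg n.
Qed.

Lemma nrm_xi_le : nrm (xi w tens eta) <= Num.sqrt C.
Proof.
apply/ler_addgt0Pl => e e0.
have /cvgn_nrmP/(_ _ e0)[N /(_ N (leqnn N)) NP] := xi_series_cvg.
rewrite -[xi _ _ _](subrK (xi_series w tens eta N)) (le_trans (nrmD _ _)) //.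
rewrite lerD // -(ger0_norm (nrm_ge0 _)) -sqrtr_sqr ler_wsqrtr //.
by rewrite nrm_xi_series.
Qed.

Lemma xi_dot u : hdot (xi w tens eta) (tens u) = \prod_(x <- u) hdot eta x.
Proof.
apply/subr0_eq/nrm_small => e e0.
have d0 : 0 < e / (nrm (tens u) + 1) by rewrite divr_gt0 // ltr_wpDl ?nrm_ge0.
have /cvgn_nrmP/(_ _ d0)[N NP] := xi_series_cvg.
pose n := maxn N (size u).+1; have := xi_series_dot eta n u.
rewrite leq_max ltnSn orbT => <-.
rewrite -hdotBl (le_trans (cauchy_schwarz _ _)) //.
have -> : e = e / (nrm (tens u) + 1) * (nrm (tens u) + 1).
  by field; rewrite gt_eqF // ltr_wpDl ?nrm_ge0.
by rewrite ler_pM ?nrm_ge0 ?lerDl // NP ?leq_maxl.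
Qed.

End Bounded.

End XiSeries.

Section Multiplication.
Context {R : realType} {H F : hilbertType R}.
Variables (w : nat -> R) (tens : seq H -> F) (mul : {bilinear F -> F -> F}).
Hypothesis w0 : w 0 = 1.
Hypothesis F_fock : weighted_fock w tens.
Hypothesis mul_fock : fock_product tens mul.

Lemma nrm_tens0 : nrm (tens [::]) = 1.
Proof.
apply/eqP; rewrite -(@eqrXn2 _ 2) ?nrm_ge0 //; apply/eqP/complexI.
by rewrite -hdot_nrm (fock_dot F_fock) /= big_nil w0 mulr1.
Qed.

Lemma fock_product_bound : exists2 M : R, 0 < M &
  forall f g, nrm (mul f g) <= M * nrm f * nrm g.
Proof.
have [M MP] := fock_mul_bounded mul_fock.
have M0 : 0 <= M.
  have := MP (tens [::]) (tens [::]).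
  by rewrite [`|tens _|]nrmE nrm_tens0 !mulr1; apply: le_trans.
have ME : M = (complex.Re M)%:C%C by rewrite RRe_real // ger0_real.
exists (complex.Re M + 1) => [|f g].
  by rewrite ltr_wpDl // -ler0c -ME.
apply: (@le_trans _ _ (complex.Re M * nrm f * nrm g)).
  by rewrite -lecR !(rmorphM (real_complex R)) /= -ME -!nrmE.
by rewrite -!mulrA ler_wpM2r ?mulr_ge0 ?nrm_ge0 // lerDl.
Qed.

Lemma bounded_functional_mull (phi : F -> R[i]) g :
  bounded_functional phi -> bounded_functional (fun f => phi (mul f g)).
Proof.
move=> bphi; have [M M0 MP] := bounded_functionalP _ bphi.
have [K K0 KP] := fock_product_bound; split.
  by move=> a x y; rewrite linearDl linearZl_LR bphi.1.
exists (M * K * nrm g) => x; rewrite (le_trans (MP _)) // -!mulrA.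
by rewrite ler_pM2l // [nrm g * _]mulrC mulrA.
Qed.

Lemma bounded_functional_mulr (phi : F -> R[i]) f :
  bounded_functional phi -> bounded_functional (fun g => phi (mul f g)).
Proof.
move=> bphi; have [M M0 MP] := bounded_functionalP _ bphi.
have [K K0 KP] := fock_product_bound; split.
  by move=> a x y; rewrite linearDr linearZr_LR bphi.1.
exists (M * K * nrm f) => x; rewrite (le_trans (MP _)) // -!mulrA.
by rewrite ler_pM2l // mulrA.
Qed.

Lemma multiplicative_on_tens (chi : F -> R[i]) : bounded_functional chi ->
  (forall u v, chi (tens (u ++ v)) = chi (tens u) * chi (tens v)) ->
  forall f g, chi (mul f g) = chi f * chi g.
Proof.
move=> bchi chiM f g; apply/subr0_eq; move: f.
have tensr v f : chi (mul f (tens v)) = chi f * chi (tens v).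
  apply/subr0_eq; move: f; apply: (fock_functional_eq0 _ _ F_fock).
    apply: bounded_functionalB; first exact: bounded_functional_mull.
    under [X in bounded_functional X]eq_fun do rewrite mulrC.
    exact: bounded_functionalMl.
  by move=> u; rewrite (fock_mul_tens mul_fock) chiM subrr.
move=> f; move: g; apply: (fock_functional_eq0 _ _ F_fock).
  apply: bounded_functionalB; first exact: bounded_functional_mulr.
  exact: bounded_functionalMl.
by move=> v; rewrite tensr subrr.
Qed.

(* A solution of g = f + f g would give chi g = 1 + chi g if chi f = 1. *)
Lemma neumann M f : (forall f g, nrm (mul f g) <= M * nrm f * nrm g) ->
  0 <= M -> M * nrm f < 1 -> exists g, g = f + mul f g.
Proof.
move=> MP M0 q1; set q := M * nrm f in q1.
have q0 : 0 <= q by rewrite mulr_ge0 ?nrm_ge0.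
pose s n := iter n (fun g => f + mul f g) 0.
have step n : nrm (s n.+1 - s n) <= nrm f * q ^+ n.
  elim: n => [|n IH]; first by rewrite /s /= linear0r addr0 subr0 mulr1.
  rewrite {1}/s iterS -/(s n.+1) {2}/s iterS -/(s n) opprD addrACA subrr add0r.
  by rewrite -linearBr (le_trans (MP _ _)) // -/q exprS mulrCA ler_wpM2l.
have dist m n : nrm (s m - s (m + n)%N) <= \sum_(m <= k < m + n) nrm f * q ^+ k.
  elim: n => [|n IH]; first by rewrite addn0 subrr nrm0 big_geq.
  rewrite addnS big_nat_recr ?leq_addr //=.
  rewrite -(subrK (s (m + n)%N) (s m)) -addrA (le_trans (nrmD _ _)) // lerD //.
  by rewrite nrmB step.
have geo_cvg : cvgn (series (geometric (nrm f) q)).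
  by apply: is_cvg_geometric_series; rewrite ger0_norm.
have [g sg] : exists g : F, s @ \oo --> g.
  exists (limn s); apply: cauchy_cvgn_nrm => e e0.
  have /cauchy_cvgP/cauchy_seriesP/(_ _ e0) := geo_cvg.
  move=> [[A B] /= [[N1 _ N1P] [N2 _ N2P]] ABP].
  pose N := maxn N1 N2; exists N => n Nn.
  have /= := ABP (N, n) (conj (N1P N (leq_maxl _ _))
    (N2P n (leq_trans (leq_maxr _ _) Nn))).
  move=> /ltW; apply: le_trans; rewrite -(subnKC Nn) (le_trans (dist _ _)) //.
  exact: ler_norm.
exists g; apply/subr0_eq/nrm_small => e e0.
have e20 : 0 < e / 2 by lra.
have /cvgn_nrmP/(_ _ e20)[N NP] := sg.
rewrite -[X in X - _](subrK (s N.+1) g) -addrA (le_trans (nrmD _ _)) //.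
have -> : s N.+1 - (f + mul f g) = mul f (s N - g).
  by rewrite {1}/s iterS -/(s N) opprD addrACA subrr add0r -linearBr.
rewrite [leRHS]splitr lerD ?NP // (le_trans (MP _ _)) // -/q nrmB.
by rewrite (le_trans _ (NP N (leqnn N))) // ler_piMl ?nrm_ge0 // ltW.
Qed.

Lemma character_bounded (chi : F -> R[i]) : scalar chi ->
  (forall f g, chi (mul f g) = chi f * chi g) -> bounded_functional chi.
Proof.
move=> schi chiM; split=> //; have [M M0 MP] := fock_product_bound.
exists M => f; rewrite leNgt; apply/negP => fM.
have chif0 : chi f != 0.
  apply: contraTneq fM => ->; rewrite nrm0 -leNgt.
  by rewrite mulr_ge0 ?nrm_ge0 ?ltW.
have nf : 0 < nrm (chi f).
  by apply: le_lt_trans fM; rewrite mulr_ge0 ?nrm_ge0 ?ltW.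
have [||g gE] := neumann M ((chi f)^-1 *: f) MP; first exact: ltW.
  rewrite nrmZ mulrCA; have -> : nrm (chi f)^-1 = (nrm (chi f))^-1.
    by apply: complexI; rewrite fmorphV /= -!nrmE normfV.
  by rewrite mulrC ltr_pdivrMr // mul1r.
have := congr1 chi gE; rewrite (scalar_fD schi) chiM (scalar_fZ schi).
rewrite mulVf // mul1r -[LHS]add0r => /addIr/esym/eqP.
by rewrite oner_eq0.
Qed.

End Multiplication.

Section PointwiseTopology.

Lemma ptws_cvgP {I : Type} {T : topologicalType}
    (G : set_system {ptws I -> T}) {FG : Filter G} (f : {ptws I -> T}) :
  G --> f <-> forall i, (fun g : {ptws I -> T} => g i) @ G --> f i.
Proof.
rewrite cvg_sup; split=> Gf i.
  by move=> A /initial_continuous/Gf.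
move=> A [B [[U oU <-] Ufi] UA]; apply: filterS UA _.
by apply: Gf; exact: open_nbhs_nbhs.
Qed.

Context {R : realType} {H : hilbertType R}.

Lemma weak_cvgP (G : set_system (weak H)) {FG : Filter G} (x : H) :
  G --> (x : weak H) <-> forall y, hdot y @ G --> hdot y x.
Proof.
split=> [Gx y|Gx].
  have y_dual : scalar (hdot y) /\ continuous (hdot y).
    split; first exact: hdot_scalar.
    exact/bounded_functional_continuous/hdot_bounded.
  have : dual_eval (H := H) @ G --> dual_eval (x : H).
    by move=> A /initial_continuous/Gx.
  by move=> /ptws_cvgP/(_ (exist _ _ y_dual)).
move=> A [B [[U oU <-] Ufi] UA]; apply: filterS UA _.
suff : dual_eval (H := H) @ G --> dual_eval (x : H).
  by apply; exact: open_nbhs_nbhs.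
apply/ptws_cvgP => -[phi [sphi cphi]].
have [y phiE] := riesz _ (continuous_bounded_functional _ sphi cphi).
have {}phiE : phi = hdot y by apply/funext.
by subst phi; exact: Gx.
Qed.

End PointwiseTopology.

Section Spectrum.
Context {R : realType} {H F : hilbertType R}.
Variables (w : nat -> R) (tens : seq H -> F) (mul : {bilinear F -> F -> F}).
Variable C : R.
Hypothesis w_gt0 : forall n, 0 < w n.
Hypothesis w0 : w 0 = 1.
Hypothesis w_conv : forall n, nat_conv (wm2 w) (wm2 w) n <= C * wm2 w n.
Hypothesis F_fock : weighted_fock w tens.
Hypothesis mul_fock : fock_product tens mul.
Implicit Types (eta : H) (u : seq H).

Lemma weight_sum_fock_ball eta : fock_ball H w eta ->
  forall N, weight_sum w (nrm eta) N <= C.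
Proof. by move=> ?; exact: weight_sum_ball_le (nrm_ge0 _) _. Qed.

Lemma character_of_tens eta u : fock_ball H w eta ->
  character_of w tens eta (tens u) = \prod_(x <- u) hdot eta x.
Proof.
move=> eta_ball; apply: (xi_dot _ _ w_gt0 F_fock).
exact: weight_sum_fock_ball.
Qed.

Lemma character_of_spectrum eta : fock_ball H w eta ->
  spectrum mul (character_of w tens eta).
Proof.
move=> eta_ball; split; first exact: hdot_scalar.
  apply: (multiplicative_on_tens _ _ _ w0 F_fock mul_fock).
    exact: hdot_bounded.
  by move=> u v; rewrite !character_of_tens // big_cat.
by exists (tens [::]); rewrite character_of_tens // big_nil oner_eq0.
Qed.

Lemma character_of_inj eta eta' : fock_ball H w eta -> fock_ball H w eta' ->
  character_of w tens eta = character_of w tens eta' -> eta = eta'.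
Proof.
move=> eta_ball eta'_ball chiE; apply: hdot_inj => x.
have := congr1 (fun chi => chi (tens [:: x])) chiE.
by rewrite !character_of_tens // !big_seq1.
Qed.

Lemma fock_ball_weight_sum eta B : (forall N, weight_sum w (nrm eta) N <= B) ->
  fock_ball H w eta.
Proof.
move=> etaB; apply: ereal_sup_ubound; exists (nrm eta)%:C%C; last first.
  by congr (_%:E); rewrite -[LHS]/(nrm _) nrm_real ger0_norm ?nrm_ge0.
have W_cvg : cvgn (weight_sum w (nrm eta)).
  apply: nondecreasing_is_cvgn; last by exists B => _ [n _ <-].
  apply/nondecreasing_seqP => n; rewrite /weight_sum big_ord_recr /= lerDl.
  by rewrite mulr_ge0 ?(wm2_ge0 _ w_gt0) // exprn_ge0 ?nrm_ge0.
apply/cvg_ex; exists (limn (weight_sum w (nrm eta)))%:C%C.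
apply/cvgn_nrmP => e e0.
have /cvgrPdist_le/(_ e e0)[N _ NP] := W_cvg; exists N => n /NP /=.
rewrite -nrm_real rmorphB /=; apply: le_trans; rewrite le_eqVlt.
apply/predU1P; left.
congr (nrm (_ - _)); rewrite /series /= big_mkord rmorph_sum.
by apply: eq_bigr => k _; rewrite rmorphM rmorphXn.
Qed.

Lemma spectrum_character_of (chi : F -> R[i]) : spectrum mul chi ->
  exists2 eta, fock_ball H w eta & chi = character_of w tens eta.
Proof.
move=> [schi chiM chi_neq0].
have bchi := character_bounded _ _ _ w0 F_fock mul_fock _ schi chiM.
have chi0 : chi (tens [::]) = 1.
  have : chi (tens [::]) * (chi (tens [::]) - 1) = 0.
    by rewrite mulrBr mulr1 -chiM (fock_mul_tens mul_fock) subrr.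
  move=> /eqP; rewrite mulf_eq0 subr_eq0 => /orP[]/eqP // chi0.
  have [f /eqP[]] := chi_neq0.
  apply: (fock_functional_eq0 _ _ F_fock _ bchi) => u.
  by rewrite -[u]/([::] ++ u) -(fock_mul_tens mul_fock) chiM chi0 mul0r.
have [eta etaP] : exists eta, forall x, chi (tens [:: x]) = hdot eta x.
  apply: riesz; split.
    by move=> a x y; rewrite (tens1_linear _ _ F_fock) schi.
  have [M M0 MP] := bounded_functionalP _ bchi; exists (M * w 1) => x.
  by rewrite -mulrA -(nrm_tens1 _ _ w_gt0 F_fock).
have chi_tens u : chi (tens u) = \prod_(x <- u) hdot eta x.
  elim: u => [|x u IH]; first by rewrite big_nil.
  by rewrite big_cons -cat1s -(fock_mul_tens mul_fock) chiM IH etaP.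
have chi_xi N : chi (xi_series w tens eta N) = (weight_sum w (nrm eta) N)%:C%C.
  rewrite /xi_series /series /= (scalar_fsum _ _ _ _ schi) big_mkord rmorph_sum.
  apply: eq_bigr => k _; rewrite (scalar_fZ schi) chi_tens rmorphM exprM.
  by rewrite rmorphXn /= -hdot_nrm big_nseq -Monoid.iteropE.
have [M M0 MP] := bounded_functionalP _ bchi.
have eta_ball : fock_ball H w eta.
  apply: (@fock_ball_weight_sum _ (M ^+ 2)) => N.
  rewrite -(nrm_xi_series _ _ w_gt0 F_fock).
  have := MP (xi_series w tens eta N); rewrite chi_xi nrm_real.
  rewrite -(nrm_xi_series _ _ w_gt0 F_fock) ger0_norm ?sqr_ge0 // expr2.
  have := nrm_ge0 (xi_series w tens eta N); rewrite le_eqVlt => /predU1P[<-|p0].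
    by rewrite mulr0 sqr_ge0.
  by rewrite ler_pM2r // expr2 => pM; rewrite ler_pM // ltW.
exists eta => //; apply: (fock_functional_eq _ _ F_fock _ _ bchi).
  exact: hdot_bounded.
by move=> u; rewrite chi_tens character_of_tens.
Qed.

End Spectrum.

Section CharacterTopology.
Context {R : realType} {H F : hilbertType R}.
Variables (w : nat -> R) (tens : seq H -> F).
Variable C : R.
Hypothesis w_gt0 : forall n, 0 < w n.
Hypothesis w_conv : forall n, nat_conv (wm2 w) (wm2 w) n <= C * wm2 w n.
Hypothesis F_fock : weighted_fock w tens.

Lemma cvg_conjc {T : Type} (G : set_system T) {FG : Filter G}
    (f : T -> R[i]) (l : R[i]) :
  f @ G --> l -> (f t)^*%C @[t --> G] --> l^*%C.
Proof.
move=> /cvg_nrmP fl; apply/cvg_nrmP => e /fl; apply: filterS => t.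
by rewrite -rmorphB nrm_conj.
Qed.

Section CoordinatewiseLimits.
Variables (G : set_system H) (eta : H).
Context {FG : Filter G}.
Hypothesis G_eta : forall x, hdot y x @[y --> G] --> hdot eta x.

Lemma cvg_prod_hdotl (u : seq H) :
  \prod_(x <- u) hdot y x @[y --> G] --> \prod_(x <- u) hdot eta x.
Proof.
elim: u => [|x u IH].
  by rewrite big_nil; under eq_fun do rewrite big_nil; apply: cvg_cst.
rewrite big_cons; under eq_fun do rewrite big_cons.
exact: cvgM (G_eta x) IH.
Qed.

Lemma cvg_tensor_sum (s : seq (R[i] * seq H)) :
  \sum_(p <- s) p.1 * \prod_(x <- p.2) hdot y x @[y --> G] -->
  \sum_(p <- s) p.1 * \prod_(x <- p.2) hdot eta x.
Proof.
elim: s => [|p s IH].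
  by rewrite big_nil; under eq_fun do rewrite big_nil; apply: cvg_cst.
rewrite big_cons; under eq_fun do rewrite big_cons.
apply: cvgD IH; apply: cvgM; first exact: cvg_cst.
exact: cvg_prod_hdotl.
Qed.

End CoordinatewiseLimits.

Lemma hdotl_weak_cvg (eta x : H) :
  hdot y x @[y --> (eta : weak H)] --> hdot eta x.
Proof.
have /weak_cvgP/(_ x)/cvg_conjc := @cvg_id _ (nbhs (eta : weak H)).
by rewrite -hdotC; under eq_fun do rewrite -hdotC.
Qed.

(* Characters are uniformly bounded on the ball, so convergence on the dense
   span of the elementary tensors suffices. *)
Lemma character_of_continuous : {within (fock_ball H w : set (weak H)),
  continuous (character_of w tens : weak H -> {ptws F -> R[i]})}.
Proof.
apply/subspace_continuousP => eta eta_ball; apply/ptws_cvgP => f.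
apply/cvg_nrmP => e e0; pose K := Num.sqrt C + 1.
have K0 : 0 < K by rewrite ltr_wpDl ?sqrtr_ge0.
have d0 : 0 < (e / (4 * K))%:C%C :> R[i] by rewrite ltcR divr_gt0 // mulr_gt0.
have [||d] := fock_dense F_fock (O := ball f (e / (4 * K))%:C%C);
  [|exact: ball_open|].
  by exists f; exact: ballxx.
rewrite -ball_normE /= nrmE ltcR => -[fd [s dE]].
have char_d y : fock_ball H w y -> character_of w tens y d =
    \sum_(p <- s) p.1 * \prod_(x <- p.2) hdot y x.
  move=> y_ball; rewrite /character_of dE hdot_sumr; apply: eq_bigr => p _.
  by rewrite hdotZr -(character_of_tens _ _ _ w_gt0 w_conv F_fock).
have char_fd y : fock_ball H w y ->
    nrm (character_of w tens y f - character_of w tens y d) <= e / 4.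
  move=> y_ball; rewrite -hdotBr (le_trans (cauchy_schwarz _ _)) //.
  have -> : e / 4 = K * (e / (4 * K)) by field; rewrite gt_eqF.
  rewrite ler_pM ?nrm_ge0 ?(ltW fd) //.
  rewrite (@le_trans _ _ (Num.sqrt C)) ?lerDl //.
  apply: (nrm_xi_le _ _ w_gt0 F_fock).
  exact: weight_sum_fock_ball w_gt0 w_conv _ y_ball.
have e20 : 0 < e / 2 by rewrite divr_gt0.
have /cvg_nrmP/(_ _ e20) := cvg_tensor_sum _ _ (FG := @nbhs_filter (weak H) eta)
  (hdotl_weak_cvg eta) s.
rewrite near_simpl near_withinE; apply: filterS => y ye y_ball.
have -> : character_of w tens eta f - character_of w tens y f =
    (character_of w tens eta f - character_of w tens eta d) +
    (character_of w tens eta d - character_of w tens y d) -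
    (character_of w tens y f - character_of w tens y d) by ring.
rewrite (le_trans (nrmD _ _)) // nrmN.
have -> : e = e / 4 + e / 2 + e / 4 by field.
rewrite lerD ?char_fd // (le_trans (nrmD _ _)) // lerD ?char_fd //.
by rewrite !char_d.
Qed.

Lemma inverse_continuous (B : set {ptws F -> R[i]})
    (g : {ptws F -> R[i]} -> H) :
  (forall chi, B chi -> forall x, hdot (g chi) x = chi (tens [:: x])) ->
  {within B, continuous (g : {ptws F -> R[i]} -> weak H)}.
Proof.
move=> gE; apply/subspace_continuousP => chi Bchi; apply/weak_cvgP => y.
apply/cvg_nrmP => e e0.
have /ptws_cvgP/(_ (tens [:: y]))/cvg_nrmP/(_ e e0) near_chi :=
  @cvg_id _ (nbhs chi).
suff : \forall psi \near chi, B psi ->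
  nrm (hdot y (g chi) - hdot y (g psi)) <= e by [].
apply: (@filterS _ _ (nbhs_filter chi) _ _ _ near_chi) => psi psie Bpsi.
rewrite [hdot y (g chi)]hdotC [hdot y (g psi)]hdotC -rmorphB nrm_conj.
by rewrite !gE.
Qed.

End CharacterTopology.

Theorem proposition8 (R : realType) (H : hilbertType R)
    (H_separable : separable H)
    (w : nat -> R)
    (w_gt0 : forall n, 0 < w n)
    (w0 : w 0%N = 1)
    (w_l2 : cvgn (series (fun n => `|(w n)^-1| ^+ 2)))
    (w_conv : exists C : R, forall n,
       nat_conv (wm2 w) (wm2 w) n <= C * wm2 w n)
    (F : hilbertType R) (tens : seq H -> F)
    (F_fock : weighted_fock w tens)
    (mul : {bilinear F -> F -> F})
    (mul_fock : fock_product tens mul) :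
  [/\ forall eta : H, fock_ball H w eta -> cvgn (xi_series w tens eta),
      spectrum mul =
        [set chi : {ptws F -> R[i]} | exists2 eta : H, fock_ball H w eta &
           chi = hdot (xi w tens eta)]
    & homeomorphism_on (fock_ball H w : set (weak H)) (spectrum mul)
        (character_of w tens)].
Proof.
have [C wC] := w_conv.
have xi_spectrum eta : fock_ball H w eta ->
    spectrum mul (character_of w tens eta).
  exact: character_of_spectrum.
have spectrum_xi chi : spectrum mul chi ->
    exists2 eta, fock_ball H w eta & chi = character_of w tens eta.
  exact: spectrum_character_of.
split.
- move=> eta eta_ball; apply/cvg_ex; exists (xi w tens eta).
  by apply: (xi_series_cvg _ _ w_gt0 F_fock); exact: weight_sum_fock_ball.
- apply/seteqP; split=> [chi /spectrum_xi //|chi [eta eta_ball ->]].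
  exact: xi_spectrum.
split.
- split=> [eta /xi_spectrum //|eta eta' /set_mem eta_ball /set_mem eta'_ball|].
    exact: character_of_inj.
  by move=> chi /spectrum_xi[eta eta_ball ->]; exists eta.
- exact: character_of_continuous.
have /choice[g gP] : forall chi : {ptws F -> R[i]}, exists eta : H,
    spectrum mul chi -> fock_ball H w eta /\ chi = character_of w tens eta.
  move=> chi.
  have [/spectrum_xi[eta eta_ball chiE]|nchi] := pselect (spectrum mul chi).
    by exists eta.
  by exists 0.
exists g => [eta /set_mem eta_ball|].
  have [g_ball gE] := gP _ (xi_spectrum _ eta_ball).
  by apply: esym; apply: character_of_inj gE.
apply: (inverse_continuous tens) => chi /gP[g_ball chiE] x.
by rewrite [in RHS]chiE (character_of_tens _ _ _ w_gt0 wC F_fock) // big_seq1.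
Qed.
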